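(* Let $\mathcal{F} = \{f_{\lambda}(\mathbf{t}) : \lambda\in\Lambda\}$ be a set of polynomials in $\mathbf{C}[\mathbf{t}] = \mathbf{C}[t_1,\ldots,t_n]$ and let ${}^{*}\mathcal{G} = \{g_{\lambda}(\mathbf{t}) : \lambda\in\Lambda\}$ be a set of polynomials in ${}^{*}\mathbf{C}_0[\mathbf{t}]$, indexed by the same set $\Lambda$. If ${}^{*}\mathcal{G}$ is an infinitesimal deformation of $\mathcal{F}$, then the nonstandard finite affine variety ${}^{*}V_0({}^{*}\mathcal{G})$ is an infinitesimal deformation of the affine variety $V(\mathcal{F})$. Equivalently, \[ {}^{*}V_0({}^{*}\mathcal{G}) = \left\{ \mathbf{w}\in{}^{*}\mathbf{C}_0^n : {}^{\circ}\mathbf{w}\in V(\mathcal{F}) \right\}. \]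
   Context: Let ${}^{*}\mathbf{C}$ be the field of nonstandard complex numbers (a nonstandard extension of $\mathbf{C}$ in the sense of nonstandard analysis), and let ${}^{*}\mathbf{C}_0$ be its subring of finite elements (those $w$ with $|w| \le r$ for some standard real $r$). Each $w \in {}^{*}\mathbf{C}_0$ has a standard part ${}^{\circ}w \in \mathbf{C}$, the unique standard complex number with $w - {}^{\circ}w$ infinitesimal. For $w_1,w_2 \in {}^{*}\mathbf{C}$, write $w_1 \approx w_2$ if $w_1 - w_2$ is infinitesimal. For $\mathbf{w} = (w_1,\ldots,w_n) \in {}^{*}\mathbf{C}_0^n$, let ${}^{\circ}\mathbf{w} = ({}^{\circ}w_1,\ldots,{}^{\circ}w_n) \in \mathbf{C}^n$; for $\mathbf{z}\in\mathbf{C}^n$, $\mathbf{w}\approx\mathbf{z}$ means ${}^{\circ}\mathbf{w}=\mathbf{z}$. Let $\mathbf{t}=(t_1,\ldots,t_n)$ be variables. For $I=(i_1,\ldots,i_n)$ in the set $\mathbf{N}_0^n$ of $n$-tuples of nonnegative (standard) integers, let $\mathbf{t}^I = t_1^{i_1}\cdots t_n^{i_n}$. Polynomials are ordinary polynomials, i.e. finite sums $\sum_{I\in\mathcal{I}} c_I \mathbf{t}^I$ with $\mathcal{I}$ a finite subset of $\mathbf{N}_0^n$. A polynomial $g(\mathbf{t}) = \sum_{I\in\mathcal{I}} b_I\mathbf{t}^I \in {}^{*}\mathbf{C}_0[\mathbf{t}]$ is an infinitesimal deformation of $f(\mathbf{t}) = \sum_{I\in\mathcal{I}} a_I\mathbf{t}^I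 \in \mathbf{C}[\mathbf{t}]$, written $g\approx f$, if ${}^{\circ}b_I = a_I$ for all $I \in \mathcal{I}$. The set ${}^{*}\mathcal{G}$ is an infinitesimal deformation of $\mathcal{F}$ if $g_\lambda\approx f_\lambda$ for all $\lambda\in\Lambda$. The affine variety defined by $\mathcal{F}$ is $V(\mathcal{F}) = \{\mathbf{z}\in\mathbf{C}^n : f_\lambda(\mathbf{z})=0 \text{ for all } \lambda\in\Lambda\}$. The nonstandard finite affine variety defined by ${}^{*}\mathcal{G}$ is ${}^{*}V_0({}^{*}\mathcal{G}) = \{\mathbf{w}\in{}^{*}\mathbf{C}_0^n : g_\lambda(\mathbf{w})\approx 0 \text{ for all } \lambda\in\Lambda\}$. A subset $W \subseteq {}^{*}\mathbf{C}_0^n$ is an infinitesimal deformation of a subset $Z\subseteq\mathbf{C}^n$ if $W = \{\mathbf{w}\in{}^{*}\mathbf{C}_0^n : \mathbf{w}\approx\mathbf{z} \text{ for some } \mathbf{z}\in Z\} = \{\mathbf{w}\in{}^{*}\mathbf{C}_0^n : {}^{\circ}\mathbf{w}\in Z\}$. *)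

(* Defs.v *)
From HB Require Import structures.
From mathcomp Require Import all_boot all_order all_algebra.
From mathcomp Require Import boolp classical_sets reals complex mpoly.

Set Implicit Arguments.
Unset Strict Implicit.
Unset Printing Implicit Defensive.

Import Order.TTheory GRing.Theory Num.Theory.

Local Open Scope classical_set_scope.
Local Open Scope ring_scope.
Local Open Scope complex_scope.

(* First-order formulas in the full language of T: every finitary relation on
   T is a symbol, and variables are natural numbers. The missing connectives
   and the existential quantifier are definable classically. *)
Inductive formula (T : Type) : Type :=
| FFalse
| FEq of nat & nat
| FRel (k : nat) of set (k.-tuple T) & k.-tuple nat
| FImp of formula T & formula T
| FAll of nat & formula T.
Arguments FFalse {T}.
Arguments FEq {T}.

Definition upd (M : Type) (v : nat -> M) (x : nat) (a : M) : nat -> M :=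
  fun y => if y == x then a else v y.

Fixpoint holds (T M : Type)
    (J : forall k : nat, set (k.-tuple T) -> set (k.-tuple M))
    (v : nat -> M) (phi : formula T) : Prop :=
  match phi with
  | FFalse => False
  | FEq x y => v x = v y
  | FRel k A xs => J k A [tuple of map v xs]
  | FImp p q => holds J v p -> holds J v q
  | FAll x p => forall a : M, holds J (upd v x a) p
  end.

(* A nonstandard extension of C: a proper extension whose relations *A, one
   for each finitary relation A on C, satisfy the transfer principle for all
   formulas with parameters in C. The field operations, order and absolute
   value of the extension are the ones obtained by applying * to those of C;
   as usual for a numFieldType, x <= y in C means that y - x is a nonnegative
   real, and `|x| is viewed as an element of C. *)
Record nonstandard_complex (R : realType) := NonstandardComplex {
  ns_sort :> numFieldType;
  ns_emb : R[i] -> ns_sort;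
  ns_star : forall k : nat, set (k.-tuple R[i]) -> set (k.-tuple ns_sort);
  ns_transfer : forall (phi : formula R[i]) (v : nat -> R[i]),
    holds (fun _ A => A) v phi <-> holds ns_star (ns_emb \o v) phi;
  ns_addE : forall x y z : ns_sort,
    ns_star [set [tuple a; b; a + b] | a in setT & b in setT] [tuple x; y; z]
    <-> z = x + y;
  ns_mulE : forall x y z : ns_sort,
    ns_star [set [tuple a; b; a * b] | a in setT & b in setT] [tuple x; y; z]
    <-> z = x * y;
  ns_leE : forall x y : ns_sort,
    ns_star [set t : 2.-tuple R[i] | tnth t ord0 <= tnth t ord_max]
      [tuple x; y]
    <-> x <= y;
  ns_normE : forall x y : ns_sort,
    ns_star [set [tuple a; `|a|] | a in setT] [tuple x; y] <-> y = `|x|;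
  ns_proper : exists w : ns_sort, forall z : R[i], w <> ns_emb z
}.
Arguments ns_emb {R}.
Arguments ns_star {R} n {k}.

Section Nonstandard.
Variables (R : realType) (S : nonstandard_complex R).

Definition finite (w : S) : Prop :=
  exists r : R, `|w| <= ns_emb S r%:C.

Definition infinitesimal (w : S) : Prop :=
  forall r : R, 0 < r -> `|w| < ns_emb S r%:C.

Definition approx (w1 w2 : S) : Prop := infinitesimal (w1 - w2).

(* Meaningful for finite w only; the value is 0 by convention if no standard
   number is infinitely close to w. *)
Definition st (w : S) : R[i] :=
  xget 0 [set z : R[i] | infinitesimal (w - ns_emb S z)].

Variable n : nat.

Definition finite_pt (w : 'I_n -> S) : Prop := forall i, finite (w i).

Definition st_pt (w : 'I_n -> S) : 'I_n -> R[i] := fun i => st (w i).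

(* membership in the subring of polynomials with finite coefficients *)
Definition finite_poly (g : {mpoly S[n]}) : Prop :=
  forall m : 'X_{1..n}, finite g@_m.

(* s is a common finite set of exponents over which both polynomials are
   written; coefficients at exponents of s may vanish. *)
Definition deform_poly (g : {mpoly S[n]}) (f : {mpoly R[i][n]}) : Prop :=
  exists2 s : seq 'X_{1..n},
    {subset msupp g <= s} /\ {subset msupp f <= s} &
    forall m, m \in s -> st g@_m = f@_m.

Definition deform_family (L : Type)
    (G : L -> {mpoly S[n]}) (F : L -> {mpoly R[i][n]}) : Prop :=
  forall l, deform_poly (G l) (F l).

Definition nsvariety0 (L : Type) (G : L -> {mpoly S[n]}) : set ('I_n -> S) :=
  [set w | finite_pt w /\ forall l, approx (G l).@[w] 0].

Definition deform_set (W : set ('I_n -> S)) (Z : set ('I_n -> R[i])) : Prop :=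
  W = [set w | finite_pt w /\ exists2 z, Z z & st_pt w = z].

End Nonstandard.

Definition variety (R : realType) (n : nat) (L : Type)
    (F : L -> {mpoly R[i][n]}) : set ('I_n -> R[i]) :=
  [set z | forall l, (F l).@[z] = 0].

(* Main.v *)
(* The standard part of a finite [w] exists because transfer splits [w] into
   real and imaginary parts and, for a real finite [u], the supremum of the
   standard reals below [u] is infinitely close to [u]. As the relation
   "infinitely close to a standard number" is compatible with sums and
   products, [g(w)] is infinitely close to [f(z)] whenever the coefficients of
   [g] are infinitely close to those of [f] and [w] is infinitely close to [z];
   two infinitely close standard numbers being equal, [g(w)] is infinitesimal
   iff [f(z) = 0]. *)

Require Import Defs.
From HB Require Import structures.
From mathcomp Require Import all_boot all_order all_algebra.
From mathcomp Require Import boolp classical_sets reals complex mpoly.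

Import Order.TTheory GRing.Theory Num.Theory.

Local Open Scope classical_set_scope.
Local Open Scope ring_scope.

(** * Atomic formulas for the field operations, the order and the absolute value *)

Section Atoms.
Variables (R : realType) (S : nonstandard_complex R).
Local Notation C := (R[i]).
Local Notation stdC := (fun (k : nat) (A : set (k.-tuple C)) => A).

(** The relation symbols here and below are literally the sets occurring in [ns_addE], [ns_mulE],
    [ns_leE] and [ns_normE], so the same atom can be read on both sides of transfer. *)
Definition FAdd (x y z : nat) : formula C :=
  FRel [set [tuple a; b; a + b] | a in setT & b in setT] [tuple x; y; z].
Definition FMul (x y z : nat) : formula C :=
  FRel [set [tuple a; b; a * b] | a in setT & b in setT] [tuple x; y; z].
Definition FLe (x y : nat) : formula C :=
  FRel [set t : 2.-tuple C | tnth t ord0 <= tnth t ord_max] [tuple x; y].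
Definition FNorm (x y : nat) : formula C :=
  FRel [set [tuple a; `|a|] | a in setT] [tuple x; y].

Lemma map_tuple2 (T : Type) (v : nat -> T) (x y : nat) :
  [tuple of map v [tuple x; y]] = [tuple v x; v y].
Proof. exact: val_inj. Qed.

Lemma map_tuple3 (T : Type) (v : nat -> T) (x y z : nat) :
  [tuple of map v [tuple x; y; z]] = [tuple v x; v y; v z].
Proof. exact: val_inj. Qed.

Lemma holds_FAdd (v : nat -> C) x y z :
  holds stdC v (FAdd x y z) <-> v z = v x + v y.
Proof.
rewrite /= map_tuple3; split=> [[a _ [b _ /(congr1 val) [-> -> ->]]] //|->].
by exists (v x) => //; exists (v y).
Qed.

Lemma holds_FMul (v : nat -> C) x y z :
  holds stdC v (FMul x y z) <-> v z = v x * v y.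
Proof.
rewrite /= map_tuple3; split=> [[a _ [b _ /(congr1 val) [-> -> ->]]] //|->].
by exists (v x) => //; exists (v y).
Qed.

Lemma holds_FLe (v : nat -> C) x y : holds stdC v (FLe x y) <-> v x <= v y.
Proof. by rewrite /= map_tuple2. Qed.

Lemma holds_FNorm (v : nat -> C) x y :
  holds stdC v (FNorm x y) <-> v y = `|v x|.
Proof.
rewrite /= map_tuple2; split=> [[a _ /(congr1 val) [-> ->]] //|->].
by exists (v x).
Qed.

Lemma ns_holds_FAdd (v : nat -> S) x y z :
  holds (@ns_star R S) v (FAdd x y z) <-> v z = v x + v y.
Proof. by rewrite /= map_tuple3; exact: ns_addE. Qed.

Lemma ns_holds_FMul (v : nat -> S) x y z :
  holds (@ns_star R S) v (FMul x y z) <-> v z = v x * v y.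
Proof. by rewrite /= map_tuple3; exact: ns_mulE. Qed.

Lemma ns_holds_FLe (v : nat -> S) x y :
  holds (@ns_star R S) v (FLe x y) <-> v x <= v y.
Proof. by rewrite /= map_tuple2; exact: ns_leE. Qed.

Lemma ns_holds_FNorm (v : nat -> S) x y :
  holds (@ns_star R S) v (FNorm x y) <-> v y = `|v x|.
Proof. by rewrite /= map_tuple2; exact: ns_normE. Qed.

End Atoms.

(** * The embedding of C as a morphism of ordered fields with absolute value *)

Section Embedding.
Variables (R : realType) (S : nonstandard_complex R).
Local Notation C := (R[i]).
Local Notation emb := (ns_emb S).

(** Transfer of the atom equating variables 0 and 1; a list serves as their valuation, here and in
    the next lemmas. *)
Lemma ns_emb_inj : injective emb.
Proof. by move=> x y /(ns_transfer S (FEq 0 1) (nth 0 [:: x; y])).2. Qed.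

Lemma ns_embD x y : emb (x + y) = emb x + emb y.
Proof.
have /holds_FAdd/ns_transfer/ns_holds_FAdd :
  nth 0 [:: x; y; x + y] 2 = nth 0 [:: x; y; x + y] 0 + nth 0 [:: x; y; x + y] 1.
  by [].
by [].
Qed.

Lemma ns_embM x y : emb (x * y) = emb x * emb y.
Proof.
have /holds_FMul/ns_transfer/ns_holds_FMul :
  nth 0 [:: x; y; x * y] 2 = nth 0 [:: x; y; x * y] 0 * nth 0 [:: x; y; x * y] 1.
  by [].
by [].
Qed.

Lemma ns_emb_zmod_morphism : zmod_morphism emb.
Proof.
by move=> x y; apply/(addIr (emb y)); rewrite -ns_embD !subrK.
Qed.

Lemma ns_emb_monoid_morphism : monoid_morphism emb.
Proof.
split; last exact: ns_embM.
(* By multiplicativity [emb 1] is idempotent, so it equals 1 once injectivity has excluded 0. *)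
have emb1_neq0 : emb 1 != 0.
  apply/eqP; rewrite -(subrr (emb 0)) -ns_emb_zmod_morphism subrr.
  by move/ns_emb_inj/eqP; rewrite oner_eq0.
by apply: (mulfI emb1_neq0); rewrite -ns_embM !mulr1.
Qed.

HB.instance Definition _ :=
  GRing.isZmodMorphism.Build C S emb ns_emb_zmod_morphism.
HB.instance Definition _ :=
  GRing.isMonoidMorphism.Build C S emb ns_emb_monoid_morphism.

Lemma ler_ns_emb : {mono emb : x y / x <= y}.
Proof.
move=> x y; pose v := nth 0 [:: x; y].
have [leCS leSC] := ns_transfer S (FLe R 0 1) v.
apply/idP/idP => xy.
- exact/(holds_FLe R v 0 1)/leSC/ns_holds_FLe.
- exact/(ns_holds_FLe R S (emb \o v) 0 1)/leCS/holds_FLe.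
Qed.

Lemma ltr_ns_emb : {mono emb : x y / x < y}.
Proof. exact: leW_mono ler_ns_emb. Qed.

Lemma ns_emb_norm z : emb `|z| = `|emb z|.
Proof.
have /holds_FNorm/ns_transfer/ns_holds_FNorm :
  nth 0 [:: z; `|z|] 1 = `|nth 0 [:: z; `|z|] 0| by [].
by [].
Qed.

(** The two bounds make the real and imaginary parts of a finite element finite. *)
Lemma ns_rect (w : S) : exists u v : S,
  [/\ w = u + emb 'i%C * v, u \is Num.real, v \is Num.real,
      `|u| <= `|w| & `|v| <= `|w|].
Proof.
(* Variables 0-7 stand for 'i, w, |w|, Re w, Im w, 'i Im w, |Re w|, |Im w|;
   [Re w <= |Re w|] encodes that [Re w] is real. *)
pose phi : formula C :=
  FAll 1 (FAll 2 (FImp (FNorm R 1 2) (FImp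
    (FAll 3 (FAll 4 (FAll 5 (FAll 6 (FAll 7
      (FImp (FMul R 0 4 5) (FImp (FAdd R 3 5 1)
      (FImp (FNorm R 3 6) (FImp (FNorm R 4 7)
      (FImp (FLe R 3 6) (FImp (FLe R 4 7)
      (FImp (FLe R 6 2) (FImp (FLe R 7 2)
        FFalse)))))))))))))
    FFalse))).
have : holds (fun _ A => A) (fun=> 'i%C) phi.
  move=> z m /holds_FNorm mE; have {mE} -> : m = `|z| := mE.
  (* In C, variables 3 to 7 are witnessed by the real and imaginary parts, 'i times the latter, and
     the two absolute values. *)
  move=> /(_ (complex.Re z)%:C%C (complex.Im z)%:C%C).
  move=> /(_ ('i%C * (complex.Im z)%:C%C) `|(complex.Re z)%:C%C|).
  move=> /(_ `|(complex.Im z)%:C%C|); apply.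
  - exact/holds_FMul.
  - by apply/holds_FAdd; rewrite /upd /= -complexE.
  - exact/holds_FNorm.
  - exact/holds_FNorm.
  - by apply/holds_FLe/real_ler_norm/complex_realP; eexists.
  - by apply/holds_FLe/real_ler_norm/complex_realP; eexists.
  - apply/holds_FLe; rewrite /upd /= !normc_def /= expr0n addr0 lecR.
    by rewrite ler_wsqrtr // lerDl sqr_ge0.
  - apply/holds_FLe; rewrite /upd /= !normc_def /= expr0n addr0 lecR.
    by rewrite ler_wsqrtr // lerDr sqr_ge0.
move/(ns_transfer S phi _).1 => /(_ w `|w|) decomp.
(* [phi] expresses existence as a negated universal statement, hence the argument by
   contradiction. *)
apply: contrapT => nouv; apply: decomp; first exact/ns_holds_FNorm.
move=> u v p k l /ns_holds_FMul pE /ns_holds_FAdd wE.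
move=> /ns_holds_FNorm kE /ns_holds_FNorm lE /ns_holds_FLe ru /ns_holds_FLe rv.
move=> /ns_holds_FLe uw /ns_holds_FLe vw.
rewrite /upd /= in pE wE kE lE ru rv uw vw; subst k l.
apply: nouv; exists u, v; split=> //; first by rewrite -pE.
(* An element comparable to a real one is real. *)
- by rewrite (ler_real ru) normr_real.
- by rewrite (ler_real rv) normr_real.
Qed.

(** * Finite and infinitesimal elements *)

Lemma ler_ns_embR (x y : R) : (emb x%:C%C <= emb y%:C%C) = (x <= y).
Proof. by rewrite ler_ns_emb lecR. Qed.

Lemma ltr_ns_embR (x y : R) : (emb x%:C%C < emb y%:C%C) = (x < y).
Proof. by rewrite ltr_ns_emb ltcR. Qed.

Lemma ns_embR_real (x : R) : emb x%:C%C \is Num.real.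
Proof.
by rewrite realE -(rmorph0 emb) !ler_ns_embR le_total.
Qed.

Lemma finite_ns_emb z : finite (emb z).
Proof.
have /complex_realP[r zr] : `|z| \is Num.real by exact: normr_real.
by exists r; rewrite -ns_emb_norm zr.
Qed.

(** For nonzero [z], the standard radius [|z|] would give [|z| < |z|]. *)
Lemma infinitesimal_ns_emb z : infinitesimal (emb z) -> z = 0.
Proof.
move=> z0; apply/eqP; rewrite -normr_eq0; apply: contrapT => /negP.
rewrite -normr_gt0 normr_id => z_gt0.
have /complex_realP[r zr] : `|z| \is Num.real by exact: normr_real.
move: z_gt0 (z0 r); rewrite -ns_emb_norm zr ltr_ns_embR ltxx ltcR => r_gt0.
by move/(_ r_gt0).
Qed.

Lemma infinitesimal0 : infinitesimal (0 : S).
Proof. by move=> r r_gt0; rewrite normr0 -(rmorph0 emb) ltr_ns_embR. Qed.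

Lemma infinitesimalD (a b : S) :
  infinitesimal a -> infinitesimal b -> infinitesimal (a + b).
Proof.
move=> a0 b0 r r_gt0; apply: (le_lt_trans (ler_normD a b)).
by rewrite [r]splitr !rmorphD ltrD ?a0 ?b0 // divr_gt0.
Qed.

Lemma infinitesimalN (a : S) : infinitesimal a -> infinitesimal (- a).
Proof. by move=> a0 r r_gt0; rewrite normrN a0. Qed.

Lemma infinitesimalMl (a b : S) :
  finite a -> infinitesimal b -> infinitesimal (a * b).
Proof.
(* The maximum with 1 makes the bound on [|a|] positive, so that [b] can be tested against the
   radius [r / t]. *)
move=> [s as_] b0 r r_gt0; pose t := Num.max s 1.
have t_gt0 : 0 < t by rewrite lt_max ltr01 orbT.
have at_ : `|a| <= emb t%:C%C.
  by apply: le_trans as_ _; rewrite ler_ns_embR le_max lexx.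
rewrite normrM; apply: (@le_lt_trans _ _ (emb t%:C%C * `|b|)).
  exact: ler_wpM2r.
have -> : emb r%:C%C = emb t%:C%C * emb (r / t)%:C%C.
  by rewrite -!rmorphM mulrC divfK ?gt_eqF.
by rewrite ltr_pM2l ?b0 ?divr_gt0 // -(rmorph0 emb) ltr_ns_embR.
Qed.

(** * Infinite closeness to standard numbers *)

Lemma approx_finite (w : S) z : approx w (emb z) -> finite w.
Proof.
move=> wz; have [r zr] := finite_ns_emb z.
exists (1 + r); rewrite -(subrK (emb z) w) !rmorphD.
by apply: le_trans (ler_normD _ _) (lerD (ltW (wz 1 ltr01)) zr).
Qed.

Lemma approx_unique (w : S) z1 z2 :
  approx w (emb z1) -> approx w (emb z2) -> z1 = z2.
Proof.
move=> w1 w2; apply/eqP; rewrite -subr_eq0; apply/eqP/infinitesimal_ns_emb.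
rewrite rmorphB -(subrKA w) -[emb z1 - w]opprB addrC.
exact: infinitesimalD w2 (infinitesimalN _ w1).
Qed.

Lemma approx_add (w1 w2 : S) z1 z2 :
  approx w1 (emb z1) -> approx w2 (emb z2) ->
  approx (w1 + w2) (emb (z1 + z2)).
Proof.
by move=> h1 h2; rewrite /approx rmorphD opprD addrACA; apply: infinitesimalD.
Qed.

Lemma approx_mul (w1 w2 : S) z1 z2 :
  approx w1 (emb z1) -> approx w2 (emb z2) ->
  approx (w1 * w2) (emb (z1 * z2)).
Proof.
move=> h1 h2.
(* In this splitting each infinitesimal difference has a finite factor: [w1] is close to a standard
   number and [emb z2] is standard. *)
have -> : w1 * w2 = w1 * (w2 - emb z2) + emb z2 * (w1 - emb z1) + emb (z1 * z2).
  by rewrite rmorphM mulrBr mulrBr [emb z2 * w1]mulrC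
             [emb z2 * emb z1]mulrC addrA !subrK.
rewrite /approx addrK; apply: infinitesimalD; apply: infinitesimalMl => //.
  exact: approx_finite h1.
exact: finite_ns_emb.
Qed.

Lemma approx_ns_emb z : approx (emb z) (emb z).
Proof. by rewrite /approx subrr; exact: infinitesimal0. Qed.

Lemma approx_exp (w : S) z k :
  approx w (emb z) -> approx (w ^+ k) (emb (z ^+ k)).
Proof.
move=> wz; elim: k => [|k IHk].
  by rewrite !expr0 -[X in approx X _](rmorph1 emb); exact: approx_ns_emb.
by rewrite !exprS; exact: approx_mul.
Qed.

Lemma approx_sum (I : Type) (s : seq I) (w : I -> S) (z : I -> C) :
  (forall i, approx (w i) (emb (z i))) ->
  approx (\sum_(i <- s) w i) (emb (\sum_(i <- s) z i)).
Proof.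
move=> wz; apply: (big_ind2 (fun a b => approx a (emb b))) => //.
  by rewrite -[X in approx X _](rmorph0 emb); exact: approx_ns_emb.
by move=> ? ? ? ?; exact: approx_add.
Qed.

Lemma approx_prod (I : Type) (s : seq I) (w : I -> S) (z : I -> C) :
  (forall i, approx (w i) (emb (z i))) ->
  approx (\prod_(i <- s) w i) (emb (\prod_(i <- s) z i)).
Proof.
move=> wz; apply: (big_ind2 (fun a b => approx a (emb b))) => //.
  by rewrite -[X in approx X _](rmorph1 emb); exact: approx_ns_emb.
by move=> ? ? ? ?; exact: approx_mul.
Qed.

(** * Existence of standard parts *)

Lemma real_approx (u : S) : u \is Num.real -> finite u ->
  exists c : R, approx u (emb c%:C%C).
Proof.
move=> u_real [r]; rewrite real_ler_norml // => /andP[ru ur].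
pose E := [set x : R | emb x%:C%C <= u].
have supE : has_sup E.
  split; first by exists (- r); rewrite /E /= !rmorphN.
  by exists r => x /= xu; rewrite -ler_ns_embR; exact: le_trans ur.
exists (sup E) => e e_gt0.
rewrite real_ltr_distl ?realB ?ns_embR_real // -rmorphB -rmorphD.
rewrite -(rmorphB (real_complex R)) -(rmorphD (real_complex R)).
apply/andP; split.
  (* Some [x] in [E] exceeds [sup E - e], and [emb x%:C%C <= u]. *)
  have [x xE sup_x] := sup_adherent e_gt0 supE.
  by apply: lt_le_trans xE; rewrite ltr_ns_embR.
(* Otherwise [sup E + e] would belong to [E], above its supremum. *)
rewrite real_ltNge ?ns_embR_real //; apply/negP => /(ub_le_sup supE.2).
by rewrite gerDl leNgt e_gt0.
Qed.

Lemma finite_approx (w : S) : finite w -> exists z, approx w (emb z).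
Proof.
move=> [r wr]; have [u [v [wE ur vr uw vw]]] := ns_rect w.
have [|c uc] := real_approx _ ur; first by exists r; exact: le_trans wr.
have [|d vd] := real_approx _ vr; first by exists r; exact: le_trans wr.
exists (c%:C%C + 'i%C * d%:C%C); rewrite wE; apply: approx_add => //.
by apply: approx_mul => //; exact: approx_ns_emb.
Qed.

(** Existence of a close standard number rules out the default value of [xget] in [st]. *)
Lemma approx_st (w : S) : finite w -> approx w (emb (st w)).
Proof. by move/finite_approx/xgetPex; apply. Qed.

Lemma st0 : st (0 : S) = 0.
Proof.
apply: (approx_unique 0); last first.
  by rewrite -[X in approx X _](rmorph0 emb); exact: approx_ns_emb.
by apply: approx_st; rewrite -(rmorph0 emb); exact: finite_ns_emb.
Qed.

(** * Evaluation of infinitesimally close polynomials *)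

Section Polynomials.
Variable n : nat.

(** Outside the list [s] of exponents both coefficients vanish, and [st0] applies. *)
Lemma st_mcoeff (g : {mpoly S[n]}) (f : {mpoly C[n]}) (m : 'X_{1..n}) :
  deform_poly g f -> st g@_m = f@_m.
Proof.
move=> [s [gs fs] gf]; have [/gf //|ms] := boolP (m \in s).
by rewrite !memN_msupp_eq0 ?st0 //; apply: contra ms; [exact: fs|exact: gs].
Qed.

(** With a common bound [k] on their sizes, two polynomials are evaluated as sums over the same
    exponents and can be compared term by term. *)
Lemma mevalwE (A : comNzRingType) (p : {mpoly A[n]}) (v : 'I_n -> A) k :
  (msize p <= k)%N ->
  p.@[v] = \sum_(m : 'X_{1..n < k}) p@_m * \prod_(i < n) v i ^+ m i.
Proof.
move=> pk; rewrite {1}(mpolywE pk) raddf_sum /=; apply: eq_bigr => m _.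
by rewrite mevalZ mevalX.
Qed.

Lemma approx_meval (g : {mpoly S[n]}) (f : {mpoly C[n]}) (w : 'I_n -> S) :
  finite_poly g -> deform_poly g f -> finite_pt w ->
  approx g.@[w] (emb f.@[st_pt w]).
Proof.
move=> gfin gf wfin; pose k := maxn (msize g) (msize f).
rewrite (@mevalwE _ g _ k) ?leq_maxl // (@mevalwE _ f _ k) ?leq_maxr //.
apply: approx_sum => m; apply: approx_mul.
  (* The coefficient of [f] is the standard part of that of [g], which is finite by [gfin]. *)
  by rewrite -(st_mcoeff _ _ _ gf); exact: approx_st.
by apply: approx_prod => i; apply: approx_exp; exact: approx_st.
Qed.

End Polynomials.

End Embedding.

Theorem theorem2 (R : realType) (S : nonstandard_complex R) (n : nat)
    (L : Type) (F : L -> {mpoly R[i][n]}) (G : L -> {mpoly S[n]})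
    (hG : forall l : L, finite_poly (G l))
    (hGF : deform_family G F) :
  deform_set (nsvariety0 G) (variety F) /\
  nsvariety0 G =
    [set w : 'I_n -> S | finite_pt w /\ variety F (st_pt w)].
Proof.
have varE : nsvariety0 G =
    [set w : 'I_n -> S | finite_pt w /\ variety F (st_pt w)].
  apply/seteqP; split=> w [wfin Gw]; split=> // l;
    have := approx_meval R S n _ _ w (hG l) (hGF l) wfin.
  (* Both the value of [F l] at [st_pt w] and 0 are standard and infinitely close to the value of
     [G l] at [w]. *)
  - move=> /approx_unique; apply.
    by rewrite rmorph0; exact: Gw.
  - by rewrite Gw rmorph0.
(* The point [z] in [deform_set] can only be [st_pt w]. *)
split=> //; rewrite /deform_set varE; apply/seteqP; split=> w [wfin].
- by move=> Fw; split=> //; exists (st_pt w).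
- by move=> [z Fz wz]; split=> //; rewrite wz.
Qed.
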